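(* Let $S$ be an infinite discrete semigroup that is very weakly cancellative and for which there is a uniform, finite bound on $|\mathrm{Fix}(a)|$ for $a\in S$ (i.e. there is $k\in\mathbb{N}$ with $|\mathrm{Fix}(a)|\le k$ for all $a\in S$). Then every minimal ultrafilter on $S$ is a butterfly point of $S^*$.
   Context: $\beta S$ is the set of ultrafilters on $S$ (principal ultrafilters identified with points of $S$), with the topology whose basic clopen sets are $\overline{A}=\{p\in\beta S: A\in p\}$, $A\subseteq S$; $S^*=\beta S\setminus S$ with the subspace topology. The operation of $S$ extends to $\beta S$ by: $A\in p\cdot q$ iff $\{x\in S: x^{-1}A\in q\}\in p$, where $x^{-1}A=\{y\in S: x\cdot y\in A\}$. This makes $\beta S$ a compact Hausdorff right topological semigroup; $K(\beta S)$ is its smallest two-sided ideal, and a minimal ultrafilter on $S$ is an element of $K(\beta S)$. (When $S$ is very weakly cancellative, $K(\beta S)\subseteq S^*$.) A left (resp. right) solution set in $S$ is a set of the form $\{x\in S: ax=b\}$ (resp. $\{x\in S: xa=b\}$) with $a,b\in S$. With $\kappa=|S|$, $S$ is very weakly cancellative if the union of fewer than $\kappa$ solution sets (left or right) always has cardinality less than $\kappa$. For $a\in S$, $\mathrm{Fix}(a)=\{x\in S: xa=a\}$. A point $p$ of a space $X$ is a butterfly point of $X$ if there are $A,B\subseteq X\setminus\{p\}$ with $\overline{A}\cap\overline{B}=\{p\}$. *)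

(* Defs.v *)
From HB Require Import structures.
From mathcomp Require Import all_boot.
From mathcomp Require Import all_classical all_reals all_analysis.

Set Implicit Arguments.
Unset Strict Implicit.
Unset Printing Implicit Defensive.

Local Open Scope classical_set_scope.
Local Open Scope card_scope.
Local Open Scope group_scope.

(* With choice this is equivalent to [~~ (B #<= A)] alone. *)
Definition card_lt T U (A : set T) (B : set U) : bool :=
  (A #<= B) && ~~ (B #<= A).
Notation "A '#<' B" := (card_lt A B) (at level 79) : card_scope.

(* The Stone-Cech compactification of the discrete space [T]. *)
Record beta (T : Type) := Beta {
  beta_sets :> set T -> Prop;
  beta_ultra : UltraFilter beta_sets }.

HB.instance Definition _ (T : Type) := gen_eqMixin (beta T).
HB.instance Definition _ (T : Type) := gen_choiceMixin (beta T).

Section StoneCech.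
Variable T : Type.
Local Notation beta := (beta T).

Lemma betaP (p q : beta) : beta_sets p = beta_sets q -> p = q.
Proof.
by case: p q => [p pU] [q qU] /= pq; subst q; rewrite (Prop_irrelevance pU qU).
Qed.

Definition beta_clopen (A : set T) : set beta := [set p : beta | p A].

Lemma beta_cover : \bigcup_(A in [set: set T]) beta_clopen A = [set: beta].
Proof.
apply/seteqP; split=> // p _; exists setT => //.
by rewrite /beta_clopen /=; have pU := beta_ultra p; exact: filterT.
Qed.

Lemma beta_join (A B : set T) (p : beta) :
  [set: set T] A -> [set: set T] B -> beta_clopen A p -> beta_clopen B p ->
  exists C, [/\ [set: set T] C, beta_clopen C p &
    beta_clopen C `<=` beta_clopen A `&` beta_clopen B].
Proof.
move=> _ _ pA pB; exists (A `&` B); split=> //.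
  by have pU := beta_ultra p; exact: filterI.
move=> q; rewrite /beta_clopen /= => qAB; have qU := beta_ultra q.
by split; apply: filterS qAB => x [].
Qed.

End StoneCech.

HB.instance Definition _ (T : Type) :=
  isBaseTopological.Build (beta T) (@beta_cover T) (@beta_join T).

Definition principal (T : Type) (x : T) : beta T :=
  Beta (principal_filter_ultra x).

Definition remainder (T : Type) : set (beta T) := ~` range (@principal T).

Section Product.
Variable S : semigroupType.
Implicit Types (A : set S) (p q : beta S).

Definition beta_mul_sets p q : set_system S :=
  [set A | p [set x | q [set y | A (x * y)]]].

Lemma beta_mul_ultra p q : UltraFilter (beta_mul_sets p q).
Proof.
have pU := beta_ultra p; have qU := beta_ultra q.
have FF : ProperFilter (beta_mul_sets p q).
  apply: Build_ProperFilter.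
    rewrite /beta_mul_sets /= => h; apply: (@filter_not_empty _ p).
    by apply: filterS h => x /= /filter_not_empty.
  split; rewrite /beta_mul_sets /=.
  - by apply: (@filterE _ p) => x; apply: (@filterE _ q) => y.
  - move=> A B /= pA pB.
    by apply: filterS (filterI pA pB) => x /= [qA qB]; exact: filterI.
  - move=> A B AB.
    by apply: (@filterS _ p) => x; apply: (@filterS _ q) => y; exact: AB.
split=> // G GF FG; apply/seteqP; split=> // A GA.
have [//|pA] := in_ultra_setVsetC [set x | q [set y | A (x * y)]] pU.
suff /FG GnA : beta_mul_sets p q (~` A).
  by have /filter_ex [x []] : G (A `&` ~` A) by exact: filterI.
rewrite /beta_mul_sets /=; apply: filterS pA => x /= nqA.
by have [/nqA|] := in_ultra_setVsetC [set y | A (x * y)] qU.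
Qed.

Definition beta_mul p q : beta S := Beta (beta_mul_ultra p q).

Lemma beta_mulA : associative beta_mul.
Proof.
move=> p q r; apply: betaP; apply/funext => A /=; rewrite /beta_mul_sets /=.
congr (p _); apply/funext => x; congr (q _); apply/funext => y.
by congr (r _); apply/funext => z /=; rewrite mulgA.
Qed.

HB.instance Definition _ := isSemigroup.Build (beta S) beta_mulA.

End Product.

Definition two_sided_ideal (G : semigroupType) (I : set G) : Prop :=
  I !=set0 /\ forall x y : G, I y -> I (x * y) /\ I (y * x).

(* [smallest C set0] is the intersection of all the sets satisfying [C]; it is
   the smallest ideal as soon as [G] has one, which is the case of [beta S] for
   a nonempty [S]. *)
Definition smallest_ideal (G : semigroupType) : set G :=
  smallest (@two_sided_ideal G) set0.

Definition minimal_ultrafilter (S : semigroupType) (p : beta S) : Prop :=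
  smallest_ideal p.

Definition left_solution_set (S : semigroupType) (A : set S) : Prop :=
  exists a b : S, A = [set x | a * x = b].

Definition right_solution_set (S : semigroupType) (A : set S) : Prop :=
  exists a b : S, A = [set x | x * a = b].

Definition very_weakly_cancellative (S : semigroupType) : Prop :=
  forall F : set (set S),
    (forall A, F A -> left_solution_set A \/ right_solution_set A) ->
    F #< [set: S] -> \bigcup_(A in F) A #< [set: S].

Definition Fix (S : semigroupType) (a : S) : set S := [set x | x * a = a].

Definition butterfly_point (X : topologicalType) (p : X) : Prop :=
  exists A B : set X,
    [/\ A `<=` ~` [set p], B `<=` ~` [set p] &
        closure A `&` closure B = [set p]].

(* Main.v *)
Require Import Defs.
From Stdlib Require Wellfounded.
From mathcomp Require Import finmap all_boot.
From mathcomp Require Import all_classical all_reals all_analysis.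

(** Write kappa for the cardinality of S and xq for the product of the
    principal ultrafilter at x with q.  Call an ultrafilter uniform when all its
    members have cardinality kappa.  Very weak cancellativity makes the uniform
    ultrafilters a two-sided ideal ([uniform_mull], [uniform_mulr]), so the
    minimal ultrafilter p is uniform, and hence so is every multiple of p.

    Let L be the minimal left ideal of p.  It is the closed set of all wp, and
    contains an idempotent e ([closed_idempotent]); minimality makes e a right
    identity of L ([left_minimal_mul_idem]).  Right multiplication by e is thus
    a continuous retraction onto L, so the closed set D of all q with qe = p
    meets L in p alone.  The two sides of the butterfly are L without p and D
    without p, and it remains to see that p is isolated neither in L nor in D.

    In L ([left_ideal_nonisolated]): p = zp for a uniform z, so that each
    neighbourhood of p contains xp for infinitely many x in S.  Only finitely
    many of these equal p: if xp = p then xa = a for p-almost all a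
    ([ultra_fixpoint]), so k + 1 such x would all lie in a single Fix a
    ([stabilizer_finite]).

    In D ([retraction_fiber_nonisolated]): inside a given member of p there is
    V in p with V in ve for each v in V ([ultra_star]).  Let Y be the set of the
    ultrafilters y with V in vy for each v in V: a closed semigroup containing
    e, with V in py for y in Y.  The finite intersections of the sets of y such
    that vy is in V belong to e, hence have size kappa, and a recursion of
    length kappa selects points in them so that two sets built from finite sets
    of translates of those points are disjoint ([disjoint_translates]).  One of
    these, M, is not in p, while some q in Y has M in rq for every r.  The
    closed semigroup of all yqe, y in Y, contains an idempotent; since e is
    minimal, this gives y in Y with e = e(yq)e.  Then t = eyq is in Y, te = e,
    and pt is a point of D that contains V and M, so it is close to p and
    differs from it.

    The bookkeeping on cardinals rests on the comparability of sets, on the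
    equality of an infinite cardinal with its square, and on the existence of a
    well-order with small initial segments. *)

Set Implicit Arguments.
Unset Strict Implicit.
Unset Printing Implicit Defensive.

Local Open Scope classical_set_scope.
Local Open Scope card_scope.

(** * Comparison of cardinals *)

(** Relations spare the default values that a total function between the two
    types would need, and they are what Zorn's lemma produces below. *)
Lemma card_le_relP T U (A : set T) (B : set U) :
  A #<= B <-> exists G : T -> U -> Prop,
    (forall x, A x -> exists2 y, B y & G x y) /\
    (forall x x' y, A x -> A x' -> G x y -> G x' y -> x = x').
Proof.
split=> [/card_leP[f]|[G [Gex Ginj]]].
  exists (fun x y => exists2 a : A, val a = x & val (f a) = y); split.
    move=> x Ax; exists (val (f (SigSub (mem_set Ax)))).
      exact: set_mem (valP _).
    by exists (SigSub (mem_set Ax)).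
  move=> x x' y _ _ [a <- <-] [a' <- /val_inj/inj]; rewrite !inE => ->//.
have [->|/set0P[x0 Ax0]] := eqVneq A set0; first exact: card_ge0.
have [y0 By0 _] := Gex _ Ax0.
have /choice[f fP] x : exists y, A x -> B y /\ G x y.
  have [/Gex[y By Gxy]|nAx] := pselect (A x); first by exists y.
  by exists y0.
have [g] : $|{injfun A >-> B}|.
  apply/injfunPex; exists f; first by move=> x /fP[].
  move=> x x' /set_mem Ax /set_mem Ax' fxx'.
  have [_ Gx] := fP _ Ax; have [_ Gx'] := fP _ Ax'.
  by apply: Ginj Gx _ => //; rewrite fxx'.
exact: inj_card_le g.
Qed.

Lemma inj_card_leT T U (A : set T) (B : set U) (f : T -> U) :
  (forall x, A x -> B (f x)) ->
  (forall x x', A x -> A x' -> f x = f x' -> x = x') -> A #<= B.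
Proof.
move=> fAB finj; apply/card_le_relP; exists (fun x y => f x = y); split.
  by move=> x Ax; exists (f x) => //; exact: fAB.
by move=> x x' y Ax Ax' fx fx'; apply: finj => //; rewrite fx fx'.
Qed.

(** A maximal graph of an injective partial map from [A] to [B] has all of [A]
    as domain or all of [B] as range, as otherwise it could be extended by one
    pair; in the first case the graph embeds [A], in the second its converse
    embeds [B]. *)
Lemma card_le_total T U (A : set T) (B : set U) : A #<= B \/ B #<= A.
Proof.
pose P (G : set (T * U)) := G `<=` A `*` B /\
  forall z z', G z -> G z' -> (z.1 = z'.1 <-> z.2 = z'.2).
have [F FP Ftot|G [[GAB Ginj] Gmax]] := @Zorn_bigcup _ P.
  split=> [z [G /FP[+ _]]|]; first exact.
  move=> z z' [G FG Gz] [G' FG' Gz'].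
  by have [GG'|G'G] := Ftot _ _ FG FG';
     [have [_] := FP _ FG'|have [_] := FP _ FG]; apply => //;
     [exact: GG'|exact: G'G].
have [Gdom|/existsNP[x /not_implyP[Ax Gx]]] :=
    pselect (forall x, A x -> exists y, G (x, y)).
  left; apply/card_le_relP; exists (fun x y => G (x, y)); split.
    by move=> x /Gdom[y Gxy]; exists y => //; have [] := GAB _ Gxy.
  by move=> x x' y _ _ Gxy Gx'y; exact/(Ginj _ _ Gxy Gx'y).
have [Gran|/existsNP[y /not_implyP[By Gy]]] :=
    pselect (forall y, B y -> exists x, G (x, y)).
  right; apply/card_le_relP; exists (fun y x => G (x, y)); split.
    by move=> y /Gran[x' Gxy]; exists x' => //; have [] := GAB _ Gxy.
  by move=> y y' x' _ _ Gxy Gxy'; exact/(Ginj _ _ Gxy Gxy').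
exfalso; apply: (Gmax (G `|` [set (x, y)])).
  split; first by move=> z Gz; left.
  by move=> /(_ (x, y) (or_intror erefl)) Gxy; apply: Gx; exists y.
split=> [z [/GAB//|->//]|z z' [Gz|->] [Gz'|->]//=]; first exact: Ginj.
- split=> e; [case: Gx; exists z.2|case: Gy; exists z.1];
  by rewrite -e -surjective_pairing.
- split=> e; [case: Gx; exists z'.2|case: Gy; exists z'.1];
  by rewrite e -surjective_pairing.
Qed.

Lemma card_ltE T U (A : set T) (B : set U) : (A #< B) = ~~ (B #<= A).
Proof.
rewrite /card_lt; have [->//|BA] := card_le_total A B.
by rewrite BA andbF.
Qed.

Lemma card_le_lt T U V (A : set T) (B : set U) (C : set V) :
  A #<= B -> B #< C -> A #< C.
Proof.
by move=> AB; rewrite !card_ltE; apply: contra => /card_le_trans; exact.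
Qed.

Lemma finite_card_lt T U (A : set T) (B : set U) :
  finite_set A -> infinite_set B -> A #< B.
Proof.
move=> Afin Binf; rewrite card_ltE; apply/negP => BA.
exact/Binf/card_le_finite/Afin.
Qed.

(** * Squares of infinite sets *)

Section Square.
Variables (T : Type) (D : set T).

(** [G] is the graph of a partial map on [T * T]; its diagonal is the set [A]
    for which the map will be an injection of [A `*` A] into [A]. *)
Let diag (G : set (T * T * T)) : set T := [set a | exists c, G ((a, a), c)].

Let square_embedding (G : set (T * T * T)) : Prop := [/\
  diag G `<=` D,
  forall a b c, G ((a, b), c) -> [/\ diag G a, diag G b & diag G c],
  forall a b, diag G a -> diag G b -> exists c, G ((a, b), c) &
  forall z z', G z -> G z' -> (z.1 = z'.1 <-> z.2 = z'.2)].

Let square_embedding_bigcup (F : set (set (T * T * T))) :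
  F `<=` square_embedding -> total_on F subset ->
  square_embedding (\bigcup_(G in F) G).
Proof.
move=> FP Ftot.
have diagS G : F G -> diag G `<=` diag (\bigcup_(G in F) G).
  by move=> FG a [c Gc]; exists c, G.
have two G H : F G -> F H -> exists K, [/\ F K, G `<=` K & H `<=` K].
  move=> FG FH; have [GH|HG] := Ftot _ _ FG FH.
    by exists H; split.
  by exists G; split.
split.
- by move=> a [c [G FG Gc]]; have [sub _ _ _] := FP _ FG; apply: sub; exists c.
- move=> a b c [G FG Gc]; have [_ /(_ _ _ _ Gc)[da db dc] _ _] := FP _ FG.
  by split; apply: diagS FG _ _.
- move=> a b [c [G FG Gc]] [d [H FH Hd]].
  have [K [FK GK HK]] := two _ _ FG FH.
  have [_ _ Kex _] := FP _ FK.
  have [|e Ke] := Kex a b (ex_intro _ c (GK _ Gc)); last by exists e, K.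
  by exists d; exact: HK.
- move=> z z' [G FG Gz] [H FH Hz']; have [K [FK GK HK]] := two _ _ FG FH.
  by have [_ _ _] := FP _ FK; apply; [exact: GK|exact: HK].
Qed.

(** By Zorn's lemma there is a maximal injection of a square [A `*` A] into [A],
    among the subsets [A] of [D] and the extensions of a countable one.  If
    [D `\` A] embeds in [A], then [D] embeds in two copies of [A], hence in [A],
    and the square of [D] in that of [A].  Otherwise [D `\` A] contains a copy
    of [A], which has room for the three blocks that complete the square of the
    union of [A] and its copy: the injection was not maximal. *)
Lemma infinite_card_square : infinite_set D -> D `*` D #<= D.
Proof.
move=> /infiniteP/card_le_relP[R [Rex Rinj]].
have {Rex} /choice[nu nuP] n : exists y, D y /\ R n y.
  by have [//|y Dy Rny] := Rex n; exists y.
have {R Rinj nuP} [Dnu nuI] : (forall n, D (nu n)) /\ injective nu.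
  split=> [n|m n nu_mn]; first by have [] := nuP n.
  have [_ Rm] := nuP m; have [_ Rn] := nuP n.
  by apply: Rinj Rm _ => //; rewrite nu_mn.
pose G0 : set (T * T * T) :=
  [set z | exists i j, z = ((nu i, nu j), nu (pickle (i, j)))].
have diagG0 n : diag G0 (nu n) by exists (nu (pickle (n, n))), n, n.
have G0P : square_embedding G0.
  split.
  - by move=> _ [_ [i [j [-> _ _]]]].
  - by move=> _ _ _ [i [j [-> -> ->]]].
  - move=> _ _ [_ [i [_ [-> _ _]]]] [_ [j [_ [-> _ _]]]].
    by exists (nu (pickle (i, j))), i, j.
  - move=> _ _ [i [j ->]] [i' [j' ->]] /=; split=> [[/nuI-> /nuI->]//|].
    by move=> /nuI/(pcan_inj pickleK)[-> ->].
(* Joining [G0] to every member keeps the bound of the empty chain infinite. *)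
pose P H := square_embedding (G0 `|` H).
have [F FP Ftot|H [HP Hmax]] := @Zorn_bigcup _ P.
  pose F' := [set G | exists2 H, (H = set0 \/ F H) & G = G0 `|` H].
  rewrite /P (_ : _ `|` _ = \bigcup_(G in F') G); last first.
    apply/seteqP; split=> [z [G0z|[H FH Hz]]|z [_ [H FH ->] [G0z|Hz]]].
    - by exists (G0 `|` set0); [exists set0 => //; left|left].
    - by exists (G0 `|` H); [exists H => //; right|right].
    - by left.
    - by case: FH Hz => [->//|FH Hz]; right; exists H.
  apply: square_embedding_bigcup.
    move=> _ [H [->|FH] ->]; [by rewrite setU0|exact: FP].
  move=> _ _ [H [->|FH] ->] [K [->|FK] ->]; rewrite ?setU0.
  - by left.
  - by left=> z; left.
  - by right=> z; left.
  - by have [HK|KH] := Ftot _ _ FH FK; [left|right]; exact: setUS.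
set G := G0 `|` H in HP; have {HP} [AD GA Gex GI] := HP.
have GP z z' : G z -> G z' -> (z.1 = z'.1 <-> z.2 = z'.2) by exact: GI.
set A := diag G in AD GA Gex.
have Anu n : A (nu n) by have [c] := diagG0 n; exists c; left.
have /choice[f fG] (z : T * T) : exists c, A z.1 -> A z.2 -> G (z, c).
  have [[A1 A2]|nA] := pselect (A z.1 /\ A z.2).
    by have [c Gc] := Gex _ _ A1 A2; exists c; rewrite [z]surjective_pairing.
  by exists (nu 0) => A1 A2; case: nA.
have fA a b : A a -> A b -> A (f (a, b)).
  by move=> Aa Ab; have /GA[] := fG (a, b) Aa Ab.
have fI a b c d : A a -> A b -> A c -> A d ->
    f (a, b) = f (c, d) -> a = c /\ b = d.
  move=> Aa Ab Ac Ad fab.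
  by have /GP := fG (a, b) Aa Ab => /(_ _ (fG (c, d) Ac Ad)) /= [_ /(_ fab)[]].
have fA3 n a b : A a -> A b -> A (f (nu n, f (a, b))).
  by move=> Aa Ab; apply: (fA) => //; exact: fA.
have [/card_le_relP[R [Rex RI]]|/card_le_relP[R [Rex RI]]] :=
    card_le_total (D `\` A) A.
  have /choice[h hP] x : exists y, (D `\` A) x -> A y /\ R x y.
    have [/Rex[y Ay Rxy]|nx] := pselect ((D `\` A) x); first by exists y.
    by exists x.
  have DA : D #<= A.
    pose k x := if `[< A x >] then f (nu 0, x) else f (nu 1, h x).
    apply: (inj_card_leT (f := k)); rewrite /k.
      move=> x Dx; case: asboolP => Ax; first exact: fA.
      by apply: fA => //; have [] := hP x (conj Dx Ax).
    move=> x y Dx Dy; case: asboolP => Ax; case: asboolP => Ay.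
    - by move=> /fI[].
    - have [Ahy _] := hP y (conj Dy Ay).
      by move=> /fI[]// /nuI.
    - have [Ahx _] := hP x (conj Dx Ax).
      by move=> /fI[]// /nuI.
    - have [Ahx Rx] := hP x (conj Dx Ax).
      have [Ahy Ry] := hP y (conj Dy Ay).
      by move=> /fI[]// _ hxy; apply: RI Rx _ => //; rewrite hxy.
  have /card_le_relP[Q [Qex QI]] := DA.
  have /choice[k kP] x : exists y, D x -> A y /\ Q x y.
    have [/Qex[y Ay Qxy]|nx] := pselect (D x); first by exists y.
    by exists x.
  apply: (inj_card_leT (f := fun z => f (k z.1, k z.2))).
    move=> [x y] /= [Dx Dy]; apply: AD; apply: fA.
      by have [] := kP _ Dx.
    by have [] := kP _ Dy.
  move=> [x y] [x' y'] /= [Dx Dy] [Dx' Dy'].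
  have [Ax Qx] := kP _ Dx; have [Ay Qy] := kP _ Dy.
  have [Ax' Qx'] := kP _ Dx'; have [Ay' Qy'] := kP _ Dy'.
  move=> /fI[]// kx ky; congr (_, _).
    by apply: QI Qx _ => //; rewrite kx.
  by apply: QI Qy _ => //; rewrite ky.
have /choice[h hP] x : exists y, A x -> (D `\` A) y /\ R x y.
  have [/Rex[y Ay Rxy]|nx] := pselect (A x); first by exists y.
  by exists x.
have hD a : A a -> D (h a) by move=> /hP[[]].
have hA a : A a -> ~ A (h a) by move=> /hP[[]].
have hI a b : A a -> A b -> h a = h b -> a = b.
  move=> Aa Ab hab; have [_ Ra] := hP _ Aa; have [_ Rb] := hP _ Ab.
  by apply: RI Ra _ => //; rewrite hab.
(* [e] enumerates [A] and its copy; the blocks of the new square are indexed by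
   the pairs [(s, t)] other than [(false, false)], and [c] maps them to the
   copy, separated by the distinct elements [nu (pickle (s, t))] of [A]. *)
pose e (s : bool) a := if s then h a else a.
have eI s t a b : A a -> A b -> e s a = e t b -> s = t /\ a = b.
  move=> Aa Ab; case: s; case: t => //= hab; first by split=> //; exact: hI.
    by case: (hA a) => //; rewrite hab.
  by case: (hA b) => //; rewrite -hab.
pose c s t a b := h (f (nu (pickle (s : bool, t : bool)), f (a, b))).
pose N : set (T * T * T) := [set z | exists s t a b,
  [/\ A a, A b, s || t & z = ((e s a, e t b), c s t a b)]].
have diagN x : diag (G `|` N) x <-> exists s a, A a /\ x = e s a.
  split=> [[y [Gxy|[s [t [a [b [Aa Ab _ [-> _ _]]]]]]]]|].
  - by exists false, x; split=> //; exists y.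
  - by exists s, a.
  - move=> [[] [a [Aa ->]]].
      by exists (c true true a a); right; exists true, true, a, a.
    by have [d Gd] := Aa; exists d; left.
exfalso; apply: (Hmax (H `|` N)).
  split=> [|HN]; first by move=> z; left.
  have /HN Hz : (H `|` N) ((h (nu 0), h (nu 0)), c true true (nu 0) (nu 0)).
    by right; exists true, true, (nu 0), (nu 0).
  by apply: (hA (nu 0)) => //; have [] := GA _ _ _ (or_intror Hz).
rewrite /P setUA -/G; split.
- by move=> x /diagN[[] [a [Aa ->]]]; [exact: hD|exact: AD].
- have diagG x : A x -> diag (G `|` N) x.
    by move=> Ax; apply/diagN; exists false, x.
  move=> x y z [/GA[]|[s [t [a [b [Aa Ab _ [-> -> ->]]]]]]].
    by move=> *; split; exact: diagG.
  split; apply/diagN; [by exists s, a|by exists t, b|].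
  by exists true, (f (nu (pickle (s, t)), f (a, b))); split=> //; exact: fA3.
- move=> x y /diagN[s [a [Aa ->]]] /diagN[t [b [Ab ->]]].
  have [st|] := boolP (s || t).
    by exists (c s t a b); right; exists s, t, a, b.
  case: s; case: t => //= _; have [d Gd] := Gex _ _ Aa Ab.
  by exists d; left; exact: Gd.
- have GN z z' : G z -> N z' -> (z.1 = z'.1 <-> z.2 = z'.2).
    move=> Gz [s [t [a [b [Aa Ab st ->]]]]]; move: Gz.
    case: z => [[x y] z] /GA[Ax Ay Az] /=; split=> [[xa yb]|zc].
      move: st Ax Ay; rewrite xa yb; case: s {xa} => /=.
        by move=> _ /(hA _ Aa).
      by case: t {yb} => //= _ _ /(hA _ Ab).
    by move: Az; rewrite zc => /(hA _ (fA3 _ _ _ Aa Ab)).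
  move=> z z' [Gz|Nz] [Gz'|Nz']; first exact: GP.
  - exact: GN.
  - by have [h1 h2] := GN _ _ Gz' Nz; split=> [/esym/h1|/esym/h2].
  - move: Nz Nz' => [s [t [a [b [Aa Ab _ ->]]]]].
    move=> [s' [t' [a' [b' [Aa' Ab' _ ->]]]]] /=.
    split=> [[/eI[]// -> -> /eI[]// -> ->//]|].
    move=> /(hI _ _ (fA3 _ _ _ Aa Ab) (fA3 _ _ _ Aa' Ab')).
    case/fI=> //; [exact: fA|exact: fA|].
    by move=> /nuI/(pcan_inj pickleK)[-> ->] /fI[]// -> ->.
Qed.
End Square.

(** * Sets smaller than an infinite set *)

Lemma setX_card_le T T' U U' (A : set T) (A' : set T')
    (B : set U) (B' : set U') :
  A #<= A' -> B #<= B' -> A `*` B #<= A' `*` B'.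
Proof.
move=> /card_le_relP[G [Gex GI]] /card_le_relP[H [Hex HI]].
apply/card_le_relP; exists (fun z z' => G z.1 z'.1 /\ H z.2 z'.2); split.
  move=> [x y] [/= /Gex[x' A'x' Gx] /Hex[y' B'y' Hy]].
  by exists (x', y').
move=> [x y] [x' y'] [a b] /= [Ax By] [Ax' By'] [Gx Hy] [Gx' Hy'].
by rewrite (GI _ _ _ Ax Ax' Gx Gx') (HI _ _ _ By By' Hy Hy').
Qed.

Lemma setX_card_lt T U V (A : set T) (B : set U) (C : set V) :
  infinite_set C -> A #< C -> B #< C -> A `*` B #< C.
Proof.
move=> Cinf AC BC.
have key W W' (D : set W) (E : set W') : D #<= E -> E #< C -> D `*` E #< C.
  move=> DE EC; have [Efin|Einf] := pselect (finite_set E).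
    apply: finite_card_lt => //; apply: finite_setX => //.
    exact: card_le_finite DE Efin.
  apply: card_le_lt EC; apply: card_le_trans (infinite_card_square Einf).
  exact: setX_card_le.
have [AB|BA] := card_le_total A B; first exact: key.
apply: card_le_lt (key _ _ _ _ BA AC).
apply: (inj_card_leT (f := fun z => (z.2, z.1))) => [z []//|].
by move=> [x y] [x' y'] _ _ /= [-> ->].
Qed.

Lemma bigcup_finite_card_lt I T V (D : set I) (F : I -> set T) (C : set V) :
  infinite_set C -> D #< C -> (forall i, D i -> finite_set (F i)) ->
  \bigcup_(i in D) F i #< C.
Proof.
elim/Peq : T => T in F *.
move=> Cinf DC Ffin; have [Dfin|Dinf] := pselect (finite_set D).
  by apply: finite_card_lt => //; exact: bigcup_finite.
apply: card_le_lt (DC).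
apply: card_le_trans (infinite_card_square Dinf).
apply: card_le_trans (setX_card_le (card_lexx D) (iffLR (infiniteP _) Dinf)).
have /choice[s sP] i : exists s : seq T, D i -> F i = [set` s].
  have [/Ffin/finite_seqP[s ->]|nD] := pselect (D i); first by exists s.
  by exists [::].
apply/card_le_relP; exists (fun x z => ohead (drop z.2 (s z.1)) = Some x).
split=> [x [i Di Fix]|x x' z _ _ -> []//].
move: Fix; rewrite sP// => /= xs.
exists (i, index x (s i)) => //=.
by rewrite (drop_nth x) ?index_mem//= nth_index.
Qed.

Lemma setU_card_lt T V (A B : set T) (C : set V) :
  infinite_set C -> A #< C -> B #< C -> A `|` B #< C.
Proof.
move=> Cinf; wlog BA : A B / B #<= A.
  move=> wl AC BC; have [AB|BA] := card_le_total A B; last exact: wl.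
  by rewrite setUC; exact: wl.
move=> AC BC; have /card_le_relP[G [Gex GI]] := BA.
pose F a := [set a] `|` [set b | B b /\ G b a].
apply: (@card_le_lt _ _ _ _ (\bigcup_(a in A) F a)).
  apply: subset_card_le => x [Ax|Bx]; first by exists x => //; left.
  by have [a Aa Gxa] := Gex _ Bx; exists a => //; right.
apply: bigcup_finite_card_lt => // a Aa; rewrite finite_setU; split.
  exact: finite_set1.
have [[b [Bb Gb]]|nb] := pselect (exists b, B b /\ G b a).
  by apply: sub_finite_set (finite_set1 b) => c [Bc Gc]; exact: GI Gb.
by apply: sub_finite_set (finite_set0 T) => c /(ex_intro _ c)/nb.
Qed.

(** A sequence is determined by its length and by the iterated pairing of its
    entries, the length being what makes the pairing decodable. *)
Lemma seq_card_le (T : Type) :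
  infinite_set [set: T] -> [set: seq T] #<= [set: T].
Proof.
move=> Tinf; have /infiniteP/card_le_relP[R [Rex RI]] := Tinf.
have [t0 _] := infinite_setN0 Tinf.
have /card_le_relP[Q [Qex QI]] := infinite_card_square Tinf.
have /choice[nu nuR] n : exists y, R n y.
  by have [//|y _ Rny] := Rex n; exists y.
have nuI m n : nu m = nu n -> m = n.
  by move=> e; apply: RI (nuR m) _ => //; rewrite e.
have /choice[g gQ] z : exists y, Q z y by have [//|y _ Qzy] := Qex z; exists y.
have gI z w : g z = g w -> z = w.
  by move=> e; apply: QI (gQ z) _ => //; rewrite e.
pose code := foldr (fun x t => g (x, t)) t0.
apply: (inj_card_leT (f := fun s => g (nu (size s), code s))) => // s s' _ _.
move=> /gI[/nuI]; elim: s s' => [|x s IH] [|x' s']//= [/IH{}IH] /gI[-> /IH->//].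
Qed.

(** * Well-orders and recursion *)

(** In a well-order with a large initial segment, the least large one has only
    small initial segments; embed [T] in it and pull the order back. *)
Lemma initial_well_order (T : choiceType) : infinite_set [set: T] ->
  exists lt : T -> T -> Prop, [/\ well_founded lt,
    forall x y, [\/ x = y, lt x y | lt y x] &
    forall x, [set y | lt y x] #< [set: T]].
Proof.
move=> Tinf; have [t0 _] := infinite_setN0 Tinf.
have [R Rwo] := wochoice.well_ordering_principle T.
have Rmin (X : set T) : X !=set0 -> exists2 m, X m & forall x, X x -> R m x.
  move=> [x0 Xx0].
  have [|m [[mX mmin] _]] := Rwo [pred x | `[< X x >]].
    by exists x0; exact/asboolP.
  exists m; first exact/asboolP.
  by move=> x Xx; apply: mmin; exact/asboolP.
pose lt x y := x <> y /\ R x y.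
have Ranti x y : R x y -> R y x -> x = y.
  move=> Rxy Ryx; have Rxx z : R z z.
    by have [|m -> ->//] := Rmin [set z]; exists z.
  have [|m [[]]] := Rwo (pred2 x y); first by exists x; rewrite !inE eqxx.
  move=> _ _ uni; rewrite -(uni x); last first.
    by split=> [|z]; rewrite !inE ?eqxx// => /orP[]/eqP->.
  rewrite -(uni y)//; split=> [|z]; rewrite !inE ?eqxx ?orbT//.
  by move=> /orP[]/eqP->.
have lt_wf : well_founded lt.
  move=> x; apply: contrapT => nx.
  have [|m nm mmin] := Rmin [set x | ~ Acc lt x]; first by exists x.
  apply: nm; split=> y [ym Rym]; apply: contrapT => /mmin Rmy.
  by apply: ym; exact: Ranti.
have lt_total x y : [\/ x = y, lt x y | lt y x].
  have [->|xy] := pselect (x = y); first by constructor 1.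
  have [|m] := Rmin [set x; y]; first by exists x; left.
  move=> /= [->|->] mmin; [constructor 2|constructor 3]; split=> //.
  - by apply: mmin; right.
  - by move=> yx; exact: xy.
  - by apply: mmin; left.
have [small|/existsNP[x0 big]] :=
  pselect (forall x, [set y | lt y x] #< [set: T]); first by exists lt.
have [|m mbig mmin] := Rmin [set x | ~ ([set y | lt y x] #< [set: T])].
  by exists x0.
move: mbig => /=; rewrite card_ltE => /negP/negPn/card_le_relP[G [Gex GI]].
have /choice[f fP] x : exists y, lt y m /\ G x y.
  by have [//|y ym Gxy] := Gex x; exists y.
have fI x y : f x = f y -> x = y.
  move=> e; have [_ Gx] := fP x; have [_ Gy] := fP y.
  by apply: GI Gx _ => //; rewrite e.
exists (fun x y => lt (f x) (f y)); split.
- exact: Wellfounded.Inverse_Image.wf_inverse_image.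
- move=> x y; have [/fI|h|h] := lt_total (f x) (f y);
    by [constructor 1|constructor 2|constructor 3].
- move=> x; have [+ Gx] := fP x => -[fxm Rfxm].
  apply: (@card_le_lt _ _ _ _ [set y | lt y (f x)]).
    by apply: (inj_card_leT (f := f)) => // y z _ _; exact: fI.
  apply: contrapT => /mmin Rmfx; apply: fxm; exact: Ranti.
Qed.

(** Recursive choice: each point is taken in its own set [W i], compatibly with
    the points already chosen. *)
Lemma wf_selection (I T : Type) (lt : I -> I -> Prop)
    (ok : I -> T -> I -> T -> Prop) (W : I -> set T) (t0 : T) :
  well_founded lt ->
  (forall i (t : I -> T),
     exists2 y, W i y & forall j, lt j i -> ok i y j (t j)) ->
  exists t : I -> T, forall i,
    W i (t i) /\ forall j, lt j i -> ok i (t i) j (t j).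
Proof.
move=> lt_wf step.
have /choice[g gP] (it : I * (I -> T)) : exists y, W it.1 y /\
    forall j, lt j it.1 -> ok it.1 y j (it.2 j).
  by have [y Wy oky] := step it.1 it.2; exists y.
(* [t0] is a filler for the indices at which [t] is not yet known. *)
pose F i (rec : forall j, lt j i -> T) :=
  g (i, fun j => if pselect (lt j i) is left ji then rec j ji else t0).
pose t := Wf.Fix lt_wf (fun=> T) F.
exists t => i; rewrite /t Wf.Fix_eq -/t; last first.
  move=> j r r' rr'; congr (g (_, _)); apply/funext => k.
  by case: pselect.
have [Wi oki] :=
  gP (i, fun j => if pselect (lt j i) is left _ then t j else t0).
by split=> // j ji; have := oki j ji => /=; case: pselect.
Qed.

(** * The space of ultrafilters *)

Section BetaTopology.
Variable T : Type.
Implicit Types (p q : beta T) (A B : set T).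

Lemma beta_setT p : p setT.
Proof. by have pU := beta_ultra p; exact: filterT. Qed.

Lemma beta_setI p A B : p A -> p B -> p (A `&` B).
Proof. by have pU := beta_ultra p; exact: filterI. Qed.

Lemma beta_setS p A B : A `<=` B -> p A -> p B.
Proof. by have pU := beta_ultra p; exact: filterS. Qed.

Lemma beta_set_ex p A : p A -> A !=set0.
Proof. by have pU := beta_ultra p; exact: filter_ex. Qed.

Lemma beta_setC p A : ~ p A <-> p (~` A).
Proof.
split=> [npA|pCA pA]; first by have [] := in_ultra_setVsetC A (beta_ultra p).
by have /beta_set_ex[x []] := beta_setI pA pCA.
Qed.

Lemma beta_separated p q : p <> q -> exists2 A, p A & q (~` A).
Proof.
move=> pq; apply: contrapT => nsep; apply: pq; apply: betaP.
have sub : forall A, p A -> q A.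
  move=> A pA; apply: contrapT => /beta_setC qCA; apply: nsep; by exists A.
apply/seteqP; split=> A; first exact: sub.
move=> qA; apply: contrapT => /beta_setC/sub qCA.
by have /beta_set_ex[x []] := beta_setI qA qCA.
Qed.

Lemma beta_nbhsP p (X : set (beta T)) :
  nbhs p X <-> exists2 A, p A & beta_clopen A `<=` X.
Proof.
rewrite nbhsE; split=> [[Y [[D _ <-] [A DA pA]] sub]|[A pA sub]].
  by exists A => // q qA; apply: sub; exists A.
exists (beta_clopen A) => //; split=> //.
by exists [set A] => //; rewrite bigcup_set1.
Qed.

Lemma beta_closureP (X : set (beta T)) p :
  closure X p <-> forall A, p A -> exists2 q, X q & q A.
Proof.
split=> [clp A pA|clp N /beta_nbhsP[A /clp[q Xq qA] sub]].
  have [|q [Xq qA]] := clp (beta_clopen A); first by apply/beta_nbhsP; exists A.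
  by exists q.
by exists q; split=> //; exact: sub.
Qed.

Lemma beta_clopen_closed A : closed (@beta_clopen T A).
Proof.
move=> p /beta_closureP clp; apply: contrapT => /beta_setC/clp[q qA].
by move/beta_setC; exact.
Qed.

Lemma beta_hausdorff : hausdorff_space (beta T).
Proof.
move=> p q pq; apply: contrapT => /beta_separated[A pA qCA].
have [||r [rA /beta_setC]] := pq (beta_clopen A) (beta_clopen (~` A)) => //.
- by apply/beta_nbhsP; exists A.
- by apply/beta_nbhsP; exists (~` A).
Qed.

(** An ultrafilter [F] on the space of ultrafilters converges to the ultrafilter
    of the sets whose basic clopen set is in [F]. *)
Lemma beta_compact : compact [set: beta T].
Proof.
rewrite compact_ultra => F FU _.
pose P : set_system T := [set A | F (beta_clopen A)].
have PF : ProperFilter P.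
  apply: Build_ProperFilter.
    rewrite /P /= => h; apply: (@filter_not_empty _ F).
    by apply: filterS h => p /beta_set_ex[x []].
  split; rewrite /P /=.
  - by apply: filterE => p; exact: beta_setT.
  - move=> A B FA FB; apply: (@filterS _ F _ (beta_clopen A `&` beta_clopen B)).
      by move=> p [/= pA pB]; exact: beta_setI.
    exact: filterI.
  - by move=> A B AB; apply: (@filterS _ F) => p; exact: beta_setS.
have PU : UltraFilter P.
  split=> // G GF PG; apply/seteqP; split=> // A GA.
  have [//|nA] := in_ultra_setVsetC (beta_clopen A) FU.
  suff /PG GCA : P (~` A).
    by have /filter_ex[x []] : G (A `&` ~` A) by exact: filterI.
  by apply: (@filterS _ F _ _ _ _ nA) => p /beta_setC.
exists (Beta PU); split=> // N /beta_nbhsP[A PA AN].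
exact: (@filterS _ F _ _ _ AN PA).
Qed.

End BetaTopology.

Section CompactMinimal.
Variables (X : topologicalType) (cX : compact [set: X]).

Lemma chain_bigcap_nonempty (F : set (set X)) : F !=set0 ->
  (forall A, F A -> closed A /\ A !=set0) -> total_on F subset ->
  \bigcap_(A in F) A !=set0.
Proof.
move=> F0 Fcl Ftot.
have FF : ProperFilter (filter_from F id).
  apply: filter_from_proper => [|A /Fcl[]//].
  apply: filter_from_filter => // A B FA FB.
  have [AB|BA] := Ftot _ _ FA FB.
    by exists A => // x Ax; split=> //; exact: AB.
  by exists B => // x Bx; split=> //; exact: BA.
have [x [_ clx]] := cX FF filterT.
exists x => A FA; apply: (Fcl A FA).1 => N Nx.
by apply: clx => //; exists A.
Qed.

(** The form of Zorn's lemma that yields both idempotents and minimal left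
    ideals: [Q] will be stability under product, or being a left ideal. *)
Lemma minimal_closed (Q : set X -> Prop) (C : set X) :
  (forall F : set (set X), (forall A, F A -> Q A) -> Q (\bigcap_(A in F) A)) ->
  closed C -> C !=set0 -> Q C ->
  exists M, [/\ M `<=` C, closed M, M !=set0 /\ Q M &
    forall N, closed N -> N !=set0 -> Q N -> N `<=` M -> M `<=` N].
Proof.
move=> QI Ccl C0 QC.
pose good M := [/\ closed M, M !=set0 & Q M].
(* Zorn's lemma for unions, applied to complements; meeting with [C] makes the
   empty chain harmless. *)
pose P D := good (C `&` ~` D).
have [F FP Ftot|D [[Mcl M0 QM] Dmax]] := @Zorn_bigcup _ P.
  pose F' := [set M | exists2 D, (D = set0 \/ F D) & M = C `&` ~` D].
  rewrite /P (_ : _ `&` _ = \bigcap_(M in F') M); last first.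
    apply/seteqP; split=> [x [Cx nx] _ [D FD ->]|x F'x].
      by split=> // Dx; case: FD Dx => [->//|FD Dx]; apply: nx; exists D.
    split.
      by have [|] := F'x (C `&` ~` set0) => //; exists set0 => //; left.
    move=> [D FD Dx]; have [|_] := F'x (C `&` ~` D); last exact.
    by exists D => //; right.
  have F'good M : F' M -> good M.
    by move=> [D FD ->]; case: FD => [->|/FP//]; rewrite setC0 setIT.
  split.
  - by apply: closed_bigI => M /F'good[].
  - apply: chain_bigcap_nonempty.
    + by exists C, set0; [left|rewrite setC0 setIT].
    + by move=> M /F'good[].
    + move=> _ _ [D FD ->] [E FE ->].
      have [DE|ED] : D `<=` E \/ E `<=` D.
        case: FD => [->|FD]; first by left.
        by case: FE => [->|FE]; [right|exact: Ftot].
      * by right; apply: setIS; exact: subsetC.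
      * by left; apply: setIS; exact: subsetC.
  - by apply: QI => M /F'good[].
exists (C `&` ~` D); split=> // N Ncl N0 QN NM x [Cx Dx].
apply: contrapT => nNx; apply: (Dmax (~` N)).
  split=> [y Dy /NM[]//|/(_ x nNx)//].
rewrite /P setCK (_ : C `&` N = N)//.
by apply/setIidPr => y /NM[].
Qed.

End CompactMinimal.

(** * Ultrafilters fixed by a map *)

Section UltraFixpoint.
Variables (T : Type) (f : T -> T) (p : beta T).
Hypothesis f_p : forall A, p A -> p (f @^-1` A).

(** One of the two colour classes is in [p], and so is its preimage under [f]. *)
Let no_flip (D : set T) (c : T -> bool) :
  p D -> (forall a, D a -> c (f a) = ~~ c a) -> False.
Proof.
move=> pD flip; have [pc|/beta_setC pc] := pselect (p [set a | c a]).
  have /beta_set_ex[a [[Da ca]]] := beta_setI (beta_setI pD pc) (f_p pc).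
  by rewrite /= flip// ca.
have /beta_set_ex[a [[Da /= ca]]] := beta_setI (beta_setI pD pc) (f_p pc).
by rewrite /= flip//; apply; exact/negP.
Qed.

(** Otherwise [f] has no fixed point on a member of [p].  Choose a root in each
    class of points with eventually equal orbits.  For a point [a], let [m a] be
    the time it takes to reach the orbit of the root, and [n a] the first
    position there.  Where [m] is positive its parity changes under [f]; where
    [m] is zero and [n] increases by one, so does the parity of [n].  Neither
    can happen on a member of [p], because [p] is fixed by [f].  In each class
    there is at most one other point, the last one before the orbit of the root
    closes up, so [f] would fix a point of the set of these. *)
Lemma ultra_fixpoint : p [set a | f a = a].
Proof.
apply: contrapT => /beta_setC pX.
have [t0 _] := beta_set_ex pX.
pose conn a b := exists m n, iter m f a = iter n f b.
have conn_trans a b c : conn a b -> conn b c -> conn a c.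
  move=> [m [n abE]] [k [l bcE]]; exists (k + m), (n + l).
  by rewrite iterD abE -iterD addnC iterD bcE -iterD.
have conn_sym a b : conn a b -> conn b a by move=> [m [n abE]]; exists n, m.
have /choice[g gP] (X : set T) : exists b, X !=set0 -> X b.
  by have [[b Xb]|X0] := pselect (X !=set0); [exists b|exists t0].
pose r a := g (conn a).
have rP a : conn a (r a) by apply: gP; exists a; exists 0, 0.
have rE a b : conn a b -> r a = r b.
  move=> ab; congr g; apply/funext => c; apply/propext.
  by split; apply: conn_trans => //; exact: conn_sym.
have rf a : r (f a) = r a by apply: rE; exists 0, 1.
have mP a : exists m, `[< exists n, iter m f a = iter n f (r a) >].
  by have [m [n E]] := rP a; exists m; apply/asboolP; exists n.
pose m a := ex_minn (mP a).
have m_le a k n : iter k f a = iter n f (r a) -> m a <= k.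
  rewrite /m; case: ex_minnP => j _ jmin E.
  by apply: jmin; apply/asboolP; exists n.
have m_ex a : exists n, iter (m a) f a = iter n f (r a).
  by rewrite /m; case: ex_minnP => j /asboolP.
have nP a : exists n, `[< iter (m a) f a = iter n f (r a) >].
  by have [n E] := m_ex a; exists n; exact/asboolP.
pose n a := ex_minn (nP a).
have nE a : iter (m a) f a = iter (n a) f (r a).
  by rewrite /n; case: ex_minnP => j /asboolP.
have n_le a k : iter (m a) f a = iter k f (r a) -> n a <= k.
  by rewrite /n; case: ex_minnP => j _ jmin E; apply: jmin; exact/asboolP.
have mf0 a : m a = 0 -> m (f a) = 0.
  move=> ma; apply/eqP; rewrite -leqn0; apply: (m_le _ _ (n a).+1).
  by rewrite rf /= -nE ma.
have mfS a : 0 < m a -> m a = (m (f a)).+1.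
  case ma: (m a) => [//|k] _.
  apply/eqP; rewrite eqn_leq ltnS; apply/andP; split.
    rewrite -ltnS -ma; apply: (m_le _ _ (n (f a))).
    by rewrite iterSr nE rf.
  by apply: (m_le _ _ (n a)); rewrite rf -iterSr -ma nE.
have n0E a : m a = 0 -> a = iter (n a) f (r a) by move=> ma; rewrite -nE ma.
have nfS a : m a = 0 -> n (f a) <= (n a).+1.
  by move=> ma; apply: n_le; rewrite mf0// rf /= -n0E.
have [pm|/beta_setC pm0] := pselect (p [set a | 0 < m a]).
  by apply: (no_flip (c := odd \o m)) pm _ => a /= /mfS ->; rewrite negbK.
have {pm0} pm0 : p [set a | m a = 0].
  by apply: beta_setS pm0 => a /= /negP; rewrite -eqn0Ngt => /eqP.
have [pn|/beta_setC pZ] := pselect (p [set a | n (f a) = (n a).+1]).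
  by apply: (no_flip (c := odd \o n)) pn _ => a /= ->.
pose Z := [set a | m a = 0 /\ n (f a) <> (n a).+1].
have {}pZ : p Z by apply: beta_setS (beta_setI pm0 pZ) => a [].
have Zmax a b : Z a -> m b = 0 -> r a = r b -> n b <= n a.
  move=> [ma na] mb rab.
  have nfa : n (f a) <= n a.
    by have := nfS _ ma; rewrite leq_eqVlt ltnS => /predU1P[/na|].
  (* After [n a] the orbit of the root only revisits earlier positions. *)
  have [k ka kE] : exists2 k, k <= n a & iter (n b) f (r a) = iter k f (r a).
    elim: (n b) => [|i [k]]; first by exists 0.
    rewrite leq_eqVlt => /predU1P[->|ka] /= ->; last by exists k.+1.
    by exists (n (f a)); rewrite // -n0E// -(rf a) -n0E// mf0.
  by apply: leq_trans ka; apply: n_le; rewrite mb /= -rab -kE rab -n0E.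
have /beta_set_ex[a [[Xa Za] /= Zfa]] := beta_setI (beta_setI pX pZ) (f_p pZ).
have [ma _] := Za; have [mfa _] := Zfa.
apply: Xa => /=; rewrite (n0E _ mfa) rf [RHS](n0E _ ma).
by congr (iter _ _ _); apply/eqP; rewrite eqn_leq !Zmax.
Qed.

End UltraFixpoint.

(** * Minimal left ideals and idempotents *)

Section LeftMinimal.
Variable G : semigroupType.
Implicit Types x y z w : G.
Local Open Scope group_scope.

(** Says that [x] lies in every left ideal generated by some [z * x], that is,
    that the left ideal of [x] is minimal and contains [x]. *)
Definition left_minimal x := forall z, exists w, x = w * z * x.

Lemma left_minimal_mull x y : left_minimal y -> left_minimal (x * y).
Proof.
move=> ymin z; have [w yE] := ymin (z * x); exists (x * w).
by rewrite [in LHS]yE !mulgA.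
Qed.

Lemma left_minimal_mulr x y : left_minimal y -> left_minimal (y * x).
Proof.
by move=> ymin z; have [w yE] := ymin z; exists w; rewrite {1}yE !mulgA.
Qed.

Lemma smallest_ideal_sub (I : set G) :
  two_sided_ideal I -> @smallest_ideal G `<=` I.
Proof. by move=> II x; apply; split. Qed.

Lemma smallest_ideal_left_minimal x0 x :
  left_minimal x0 -> smallest_ideal x -> left_minimal x.
Proof.
move=> x0min; apply: smallest_ideal_sub; split; first by exists x0.
by move=> z y ymin; split; [exact: left_minimal_mull|exact: left_minimal_mulr].
Qed.

(** In a minimal left ideal [x] is a left multiple of [e], which [e] fixes on
    the right. *)
Lemma left_minimal_mul_idem x y e :
  left_minimal x -> e = y * x -> e * e = e -> x * e = x.
Proof.
move=> xmin eE ee; have [w xE] := xmin y.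
have {}xE : x = w * e by rewrite eE mulgA.
by rewrite xE -mulgA ee.
Qed.

End LeftMinimal.

Section BetaSemigroup.
Variable S : semigroupType.
Implicit Types (p q : beta S) (A : set S).
Local Open Scope group_scope.

Lemma beta_mulE p q A : (p * q) A = p [set x | q [set y | A (x * y)]].
Proof. by []. Qed.

Lemma principal_mulE (x : S) q A :
  (principal x * q)%g A <-> q [set y | A (x * y)].
Proof. by rewrite beta_mulE; exact: principal_filterP. Qed.

Lemma beta_mulr_continuous q : continuous (fun p => p * q).
Proof.
move=> p N /beta_nbhsP[A pqA AN].
apply/beta_nbhsP; exists [set x | q [set y | A (x * y)]] => // r rA.
exact: AN.
Qed.

Lemma beta_mulr_closed (C : set (beta S)) q :
  closed C -> closed [set p * q | p in C].
Proof.
move=> Ccl; apply: compact_closed; first exact: beta_hausdorff.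
apply: continuous_compact.
  by apply: continuous_subspaceT; exact: beta_mulr_continuous.
by apply: subclosed_compact Ccl (@beta_compact S) _.
Qed.

Lemma beta_mulr_fiber_closed q r : closed [set p | p * q = r].
Proof.
move=> p /beta_closureP clp; apply: contrapT => /beta_separated[A pqA rCA].
have [s /= sqr sA] := clp [set x | q [set y | A (x * y)]] pqA.
by move: rCA; rewrite -sqr => /beta_setC; exact.
Qed.

Definition mul_closed (C : set (beta S)) := forall p q, C p -> C q -> C (p * q).

(** In a minimal closed subsemigroup [M] every element is idempotent: for [e] in
    [M], the closed semigroup [M e] is [M], so some [f] in [M] has [f * e = e],
    and the closed semigroup of all such [f] is again [M]. *)
Lemma closed_idempotent (C : set (beta S)) :
  closed C -> C !=set0 -> mul_closed C -> exists2 e, C e & e * e = e.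
Proof.
move=> Ccl C0 Cmul.
have [|M [MC Mcl [[e Me] Mmul] Mmin]] :=
    minimal_closed (@beta_compact S) (Q := mul_closed) _ Ccl C0 Cmul.
  by move=> F FQ p q Fp Fq A FA; apply: FQ => //; [exact: Fp|exact: Fq].
exists e; first exact: MC.
have Me_e : [set p * e | p in M] e.
  apply: Mmin => //; first exact: beta_mulr_closed.
  - by exists (e * e), e.
  - move=> _ _ [p Mp <-] [q Mq <-]; exists (p * e * q); last by rewrite !mulgA.
    by do 2!apply: (Mmul) => //.
  - by move=> _ [p Mp <-]; exact: Mmul.
have [f Mf fe] := Me_e.
have [] : (M `&` [set p | p * e = e]) e => //.
apply: Mmin => //; first by apply: closedI => //; exact: beta_mulr_fiber_closed.
- by exists f.
- move=> p q [Mp /= pe] [Mq /= qe]; split; first exact: Mmul.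
  by rewrite /= -mulgA qe.
Qed.

(** Any element of a minimal closed left ideal [M] is suitable, since the left
    ideals generated by its left multiples are closed and contained in [M]. *)
Lemma ex_left_minimal : [set: S] !=set0 -> exists p, left_minimal p.
Proof.
move=> [x0 _].
pose left_closed (C : set (beta S)) := forall p q, C q -> C (p * q).
have [|||M [_ Mcl [[p Mp] Mleft] Mmin]] :=
  minimal_closed (@beta_compact S) (Q := left_closed) (C := setT) _ closedT.
- by move=> F FQ p q Fq A FA; apply: FQ => //; exact: Fq.
- by exists (principal x0).
- by [].
exists p => z.
have [q _ qzp] : [set q * (z * p) | q in setT] p.
  apply: Mmin => //; first exact/beta_mulr_closed/closedT.
  - by exists (z * (z * p)), z.
  - by move=> q _ [r _ <-]; exists (q * r); rewrite ?mulgA.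
  - by move=> _ [q _ <-]; apply: (Mleft); exact: Mleft.
by exists q; rewrite -[in LHS]qzp mulgA.
Qed.

End BetaSemigroup.

(** * Uniform ultrafilters *)

Section Uniform.
Variable T : Type.
Hypothesis T_infinite : infinite_set [set: T].

(** With comparability of cardinals: every member of [p] has the size of [T]. *)
Definition uniform (p : beta T) := forall A, A #< [set: T] -> ~ p A.

Lemma uniform_infinite p A : uniform p -> p A -> infinite_set A.
Proof.
by move=> pU pA Afin; apply: pU pA; exact: finite_card_lt.
Qed.

Lemma uniform_remainder p : uniform p -> remainder p.
Proof.
move=> pU [x _ px]; apply: (uniform_infinite pU) (finite_set1 x).
by rewrite -px; exact/principal_filterP.
Qed.

(** The sets with small complement form a filter, by [setU_card_lt]. *)
Lemma ex_uniform : exists p, uniform p.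
Proof.
pose F : set_system T := [set A | ~` A #< [set: T]].
have FF : ProperFilter F.
  apply: Build_ProperFilter.
    by rewrite /F /= setC0 card_ltE card_lexx.
  split; rewrite /F /=.
  - by rewrite setCT; exact: finite_card_lt.
  - by move=> A B FA FB; rewrite /= setCI; exact: setU_card_lt.
  - by move=> A B AB; apply: card_le_lt; exact/subset_card_le/subsetC.
have [G [GU FG]] := ultraFilterLemma FF.
exists (Beta GU) => A AT; apply/beta_setC/FG.
by rewrite /F /= setCK.
Qed.

End Uniform.

Section VeryWeaklyCancellative.
Variable S : semigroupType.
Hypotheses (S_infinite : infinite_set [set: S])
           (S_vwc : very_weakly_cancellative S).
Implicit Types (p q : beta S) (A B : set S).
Local Open Scope group_scope.

Lemma vwc_bigcup (F : S * S -> set S) A B :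
  (forall z, left_solution_set (F z) \/ right_solution_set (F z)) ->
  A #< [set: S] -> B #< [set: S] ->
  \bigcup_(z in A `*` B) F z #< [set: S].
Proof.
move=> Fsol AS BS.
rewrite (_ : \bigcup_(z in _) _ = \bigcup_(X in F @` (A `*` B)) X); last first.
  by rewrite bigcup_image.
apply: S_vwc; first by move=> _ [z _ <-].
by apply: card_le_lt (card_image_le _ _) _; exact: setX_card_lt.
Qed.

(** Very weak cancellativity enters through this lemma and its mirror image: the
    set is a union of solution sets indexed by [A `*` B]. *)
Lemma vwc_left_card_lt A B : A #< [set: S] -> B #< [set: S] ->
  [set y | exists2 x, A x & B (x * y)] #< [set: S].
Proof.
move=> AS BS.
pose F (z : S * S) := [set y | z.1 * y = z.2].
apply: (@card_le_lt _ _ _ _ (\bigcup_(z in A `*` B) F z)); last first.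
  by apply: vwc_bigcup => // z; left; exists z.1, z.2.
by apply: subset_card_le => y [x Ax Bxy]; exists (x, x * y).
Qed.

Lemma vwc_right_card_lt A B : A #< [set: S] -> B #< [set: S] ->
  [set x | exists2 y, A y & B (x * y)] #< [set: S].
Proof.
move=> AS BS.
pose F (z : S * S) := [set x | x * z.1 = z.2].
apply: (@card_le_lt _ _ _ _ (\bigcup_(z in A `*` B) F z)); last first.
  by apply: vwc_bigcup => // z; right; exists z.1, z.2.
by apply: subset_card_le => x [y Ay Bxy]; exists (y, x * y).
Qed.

Lemma uniform_mull p q : uniform q -> uniform (p * q).
Proof.
move=> qU A AS; rewrite beta_mulE => /beta_set_ex[x /= qA].
apply: qU (vwc_left_card_lt (finite_card_lt (finite_set1 x) S_infinite) AS) _.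
by apply: beta_setS qA => y /= Axy; exists x.
Qed.

(** When [q] has a small member [B], a small [A] in [p * q] would make the set
    of the left divisors of [A] by [B] a small member of [p]; the other case is
    [uniform_mull]. *)
Lemma uniform_mulr p q : uniform p -> uniform (p * q).
Proof.
move=> pU.
have [qU|/existsNP[B /not_implyP[BS /contrapT qB]]] := pselect (uniform q).
  exact: uniform_mull.
move=> A AS; rewrite beta_mulE => pA.
apply: pU (vwc_right_card_lt BS AS) _.
apply: beta_setS pA => x /= qA.
by have /beta_set_ex[y [By Axy]] := beta_setI qB qA; exists y.
Qed.

Lemma minimal_ultrafilter_uniform p : minimal_ultrafilter p -> uniform p.
Proof.
apply: smallest_ideal_sub; split; first exact: ex_uniform.
by move=> q r rU; split; [exact: uniform_mull|exact: uniform_mulr].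
Qed.

(** Each [x] in the stabilizer fixes [p]-almost all [a] ([ultra_fixpoint]), so
    any [k.+1] of them fix a common [a]. *)
Lemma stabilizer_finite p k : (forall a : S, Fix a #<= `I_k) ->
  finite_set [set x : S | principal x * p = p].
Proof.
move=> Fixk; apply: contrapT => /(infinite_set_fset k.+1)[X Xp kX].
have pX (x : S) : x \in X -> p [set a | x * a = a].
  move=> /Xp /= xp; apply: (@ultra_fixpoint _ (fun a => x * a)) => A pA.
  by rewrite -xp in pA; move/principal_mulE : pA.
have /beta_set_ex[a aX] : p [set a | forall x, x \in X -> x * a = a].
  have all_s (s : seq S) : {subset s <= X} ->
      p [set a | forall x, x \in s -> x * a = a].
    elim: s => [|x s IH] sX.
      by apply: beta_setS (beta_setT p) => a _ x.
    apply: beta_setS (beta_setI (pX x _) (IH _)).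
    - by move=> a [/= xa sa] y; rewrite inE => /predU1P[->|/sa].
    - by apply: sX; rewrite mem_head.
    - by move=> y ys; apply: sX; rewrite inE ys orbT.
  by apply: beta_setS (all_s (enum_fset X) _) => //.
have : [set` X] #<= `I_k.
  by apply: card_le_trans (Fixk a); apply: subset_card_le => x /aX.
by move=> /geq_card_fset_set; rewrite set_fsetK leqNgt kX.
Qed.

End VeryWeaklyCancellative.

(** * Accumulation at a minimal ultrafilter *)

Section NonIsolation.
Variable S : semigroupType.
Hypotheses (S_infinite : infinite_set [set: S])
           (S_vwc : very_weakly_cancellative S).
Implicit Types (p q e : beta S) (U V : set S).
Local Open Scope group_scope.

(** Minimality gives [p = w * p * p], so [U] contains [x * p] for [w * p]-almost
    all [x], hence for infinitely many, whereas the stabilizer of [p] is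
    finite. *)
Lemma left_ideal_nonisolated p k U :
  (forall a : S, Fix a #<= `I_k) -> left_minimal p -> uniform p -> p U ->
  exists q, [/\ q U, q <> p, exists w, q = w * p & uniform q].
Proof.
move=> Fixk pmin pU Up; have [w pE] := pmin p.
have wpU : uniform (w * p) by exact: uniform_mull.
have : (w * p)%g [set x | (principal x * p)%g U].
  move: Up; rewrite {1}pE beta_mulE; apply: beta_setS => x.
  by move/principal_mulE.
move=> /(uniform_infinite S_infinite wpU).
move=> /infinite_setD/(_ (stabilizer_finite p Fixk)).
move=> /infinite_setN0[x [/= xU xp]].
exists (principal x * p); split=> //; first by exists (principal x).
exact: uniform_mull.
Qed.

(** Take the points [v] of [U] with [U] in [v * e]; they also satisfy the
    condition for [V] because [e] is idempotent. *)
Lemma ultra_star p e U : e * e = e -> p * e = p -> p U ->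
  exists V, [/\ V `<=` U, p V & forall v, V v -> e [set y | V (v * y)]].
Proof.
move=> ee pe Up; exists (U `&` [set x | e [set y | U (x * y)]]).
split=> [x []//||v [Uv eU]]; first by apply: beta_setI => //; rewrite -pe in Up.
have eeU : (e * e)%g [set y | U (v * y)] by rewrite ee.
apply: beta_setS (beta_setI eU eeU) => y [Uvy /= eUy]; split=> //=.
by apply: beta_setS eUy => z /=; rewrite mulgA.
Qed.

(** Enumerate the indices in the order type of an initial well-order.  When [i]
    is treated, the points to avoid are the solutions [y] of the equations
    [x * y = x' * t j], where [x] and [x'] are taken from the finite sequences
    of [i] and of an earlier [j]; very weak cancellativity makes their set
    small, so that it does not exhaust [W i].  The boolean in the index splits
    the result into two disjoint families that are alike. *)
Lemma disjoint_translates (W : seq S * bool -> set S) :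
  (forall i, ~ (W i #< [set: S])) ->
  exists t : seq S * bool -> S, (forall i, W i (t i)) /\
    forall i j x y, i <> j -> x \in i.1 -> y \in j.1 -> x * t i <> y * t j.
Proof.
move=> Wbig; have [t0 _] := infinite_setN0 S_infinite.
have [lt [lt_wf lt_total lt_small]] := initial_well_order S_infinite.
have /card_le_relP[G [Gex GI]] : [set: seq S * bool] #<= [set: S].
  apply: card_le_trans (infinite_card_square S_infinite).
  rewrite -setXTT; apply: setX_card_le; first exact: seq_card_le.
  apply: card_le_trans ((infiniteP _).1 S_infinite).
  by apply: (inj_card_leT (f := nat_of_bool)) => // -[] [].
have /choice[c cP] i : exists y, G i y by have [//|y _ Gy] := Gex i; exists y.
have cI i j : c i = c j -> i = j.
  by move=> e; apply: GI (cP i) _ => //; rewrite e.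
have [|i t|t tP] := @wf_selection _ _ (fun j i => lt (c j) (c i))
  (fun i y j z => forall x x', x \in i.1 -> x' \in j.1 -> x * y <> x' * z)
  W t0.
- exact: Wellfounded.Inverse_Image.wf_inverse_image.
- pose D := [set j | lt (c j) (c i)].
  pose N j := [set x * t j | x in [set` j.1]].
  have Dsmall : \bigcup_(j in D) N j #< [set: S].
    apply: bigcup_finite_card_lt => // [|j _].
      apply: card_le_lt (lt_small (c i)).
      by apply: (inj_card_leT (f := c)) => // j k _ _; exact: cI.
    exact/finite_image/finite_seq.
  have := vwc_left_card_lt S_infinite S_vwc
    (finite_card_lt (finite_seq i.1) S_infinite) Dsmall.
  set X := [set y | _] => Xsmall.
  have /existsNP[y /not_implyP[Wy nXy]] : ~ (W i `<=` X).
    move=> WX; apply: (Wbig i); apply: card_le_lt Xsmall.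
    exact: subset_card_le.
  exists y => // j ji x x' xi x'j xy; apply: nXy; exists x => //.
  by exists j => //; exists x'.
exists t; split=> [i|i j x y ij xi yj]; first by have [] := tP i.
have [/cI//|ji|ij'] := lt_total (c i) (c j).
- by have [_ /(_ _ ji)] := tP j; move=> /(_ y x yj xi) h /esym.
- by have [_ /(_ _ ij')] := tP i; exact.
Qed.

(** The point is found in the form [p * y'], where [y' * e = e] ensures that it
    lies on the fiber of [p] under right multiplication by [e], [y'] in [Y] that
    it lies in [U], and [M b] that it is not [p]. *)
Lemma retraction_fiber_nonisolated p e y0 U :
  left_minimal p -> uniform p -> e = y0 * p -> e * e = e -> p U ->
  exists q, [/\ q U, q <> p, q * e = p & uniform q].
Proof.
move=> pmin pU eE ee Up.
have pe : p * e = p by exact: left_minimal_mul_idem eE ee.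
have emin : left_minimal e by rewrite eE; exact: left_minimal_mull.
have eU : uniform e by rewrite eE; exact: uniform_mull.
have [V [VU Vp Ve]] := ultra_star ee pe Up.
pose W (i : seq S * bool) := [set y | forall v, v \in i.1 -> V v -> V (v * y)].
have eW i : e (W i).
  rewrite /W; elim: i.1 => [|v s IH].
    by apply: beta_setS (beta_setT e) => y _ v.
  have ev : e [set y | V v -> V (v * y)].
    have [/Ve eV|nVv] := pselect (V v).
      by apply: beta_setS eV => y Vvy _.
    by apply: beta_setS (beta_setT e) => y _ Vv.
  apply: beta_setS (beta_setI ev IH) => y [vy sy] u; rewrite inE.
  by case/predU1P => [->|/sy].
have [|t [tW tdisj]] := @disjoint_translates W.
  by move=> i Wsmall; exact: eU Wsmall (eW i).
pose M b := [set z | exists s x, x \in s /\ z = x * t (s, b)].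
(* [M true] and [M false] are disjoint. *)
have [b pM] : exists b, ~ p (M b).
  have [pMt|] := pselect (p (M true)); last by exists true.
  exists false => pMf.
  have /beta_set_ex[z [[s [x [xs zE]]] [s' [x' [xs']]]]] := beta_setI pMt pMf.
  by rewrite zE; exact: tdisj.
(* [q] is a limit of the points [t (s, b)] as the finite set [s] increases. *)
pose B (s0 : seq S) := [set t (s, b) | s in [set s | {subset s0 <= s}]].
have BF : ProperFilter (filter_from setT B).
  apply: filter_from_proper => [|s _]; last by exists (t (s, b)), s.
  apply: filter_from_filter; first by exists [::].
  move=> s1 s2 _ _; exists (s1 ++ s2) => //.
  move=> _ [s ss <-]; split; exists s => // x xs; apply: ss;
    by rewrite mem_cat xs ?orbT.
have [Q [QU BQ]] := ultraFilterLemma BF.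
pose q := Beta QU.
have qB x (A : set S) : (forall s, x \in s -> A (t (s, b))) -> q A.
  move=> xA; apply: (@beta_setS _ q (B [:: x])).
    by move=> _ [s xs <-]; apply: xA; apply: xs; rewrite mem_head.
  by apply: BQ; exists [:: x].
pose Y := [set y : beta S | forall v, V v -> y [set z | V (v * z)]].
have Yq : Y q.
  by move=> v Vv; apply: (qB v) => s vs; exact: (tW (s, b)).
have Ye : Y e by exact: Ve.
have Ymul : mul_closed Y.
  move=> y z yY zY v Vv; rewrite beta_mulE.
  apply: beta_setS (yY v Vv) => u /= Vvu.
  by apply: beta_setS (zY _ Vvu) => w /=; rewrite mulgA.
have Ycl : closed Y.
  rewrite (_ : Y = \bigcap_(v in V) beta_clopen [set z | V (v * z)])//.
  by apply: closed_bigI => v _; exact: beta_clopen_closed.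
have [|||g [y Yy gE] gg] := @closed_idempotent _ [set y * (q * e) | y in Y].
- exact: beta_mulr_closed.
- by exists (e * (q * e)), e.
- move=> _ _ [y Yy <-] [z Yz <-].
  exists (y * (q * e) * z); last by rewrite !mulgA.
  by do 2!apply: (Ymul) => //; exact: Ymul.
(* The idempotent [g] is in the minimal left ideal of [e], hence a right identity
   of that ideal. *)
have eg : e * g = e.
  by apply: (left_minimal_mul_idem (y := y * q)) => //; rewrite -gE mulgA.
pose y' := e * (y * q).
have Yy' : Y y' by do 2!apply: (Ymul) => //.
exists (p * y'); split.
- apply: (beta_setS VU); rewrite beta_mulE; apply: beta_setS Vp => v Vv.
  exact: Yy'.
- move=> py'; apply: pM; rewrite -py' /y' !mulgA beta_mulE.
  apply: beta_setS (beta_setT _) => x _ /=; apply: (qB x) => s xs.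
  by exists s, x.
- by rewrite /y' -!mulgA gE eg.
- exact: uniform_mulr.
Qed.

End NonIsolation.

(** * Butterfly points *)

Lemma closure_set_val (X : topologicalType) (A : set X) (Z : set A) (x : A) :
  closure Z x <-> closure [set set_val z | z in Z] (set_val x).
Proof.
split=> clZ N.
  move=> Nx; have [|z [Zz Nz]] := clZ (set_val @^-1` N).
    exact: (@initial_continuous A X set_val x).
  by exists (set_val z); split=> //; exists z.
rewrite nbhsE => -[_ [[D Dopen <-] Dx] DN].
have [|_ [[z Zz <-] Dz]] := clZ D; first exact: open_nbhs_nbhs.
by exists z; split=> //; exact: DN.
Qed.

Theorem theorem3p9 (S : semigroupType)
    (S_infinite : infinite_set [set: S])
    (S_vwc : very_weakly_cancellative S)
    (S_Fix : exists k : nat, forall a : S, Fix a #<= `I_k)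
    (p : beta S) (p_minimal : minimal_ultrafilter p) :
  exists2 q : remainder (T := S), set_val q = p & butterfly_point q.
Proof.
have [k Fixk] := S_Fix.
have pU := minimal_ultrafilter_uniform S_infinite S_vwc p_minimal.
have [p0 p0min] := ex_left_minimal (infinite_setN0 S_infinite).
have pmin := smallest_ideal_left_minimal p0min p_minimal.
pose L := [set (w * p)%g | w in [set: beta S]].
have Lcl : closed L by exact/beta_mulr_closed/closedT.
have Lmul : mul_closed L.
  by move=> _ _ [x _ <-] [y _ <-]; exists (x * p * y)%g; rewrite ?mulgA.
have [|_ [y0 _ <-] ee] := closed_idempotent Lcl _ Lmul.
  by exists (p * p)%g, p.
set e := (y0 * p)%g in ee.
have Le q : L q -> (q * e)%g = q.
  move=> [w _ <-]; rewrite -mulgA; congr (_ * _)%g.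
  exact: (@left_minimal_mul_idem _ p y0).
pose q0 : remainder (T := S) :=
  SigSub (mem_set (uniform_remainder S_infinite pU)).
pose lift (X : set (beta S)) : set (remainder (T := S)) :=
  [set q | X (set_val q) /\ set_val q <> p].
have lift_cl X : closed X -> closure (lift X) `<=` set_val @^-1` X.
  move=> Xcl q /closure_set_val clq; apply: Xcl; apply: closure_subset clq.
  by move=> _ [r [Xr _] <-].
have lift_q0 (X : set (beta S)) :
    (forall U, p U -> exists q : beta S, [/\ q U, q <> p, X q & uniform q]) ->
    closure (lift X) q0.
  move=> Xp; apply/closure_set_val/beta_closureP => U /Xp[q [qU qp Xq qunif]].
  have rq := uniform_remainder S_infinite qunif.
  by exists q => //; exists (SigSub (mem_set rq)).
exists q0 => //; exists (lift L), (lift [set q | (q * e)%g = p]); split.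
- by move=> q [_ qp] /= qq0; apply: qp; rewrite qq0.
- by move=> q [_ qp] /= qq0; apply: qp; rewrite qq0.
- apply/seteqP; split=> [q [/(lift_cl _ Lcl) /= Lq]|_ ->].
    move=> /(lift_cl _ (@beta_mulr_fiber_closed _ _ _)) /= qe.
    by apply: val_inj; rewrite -[LHS](Le _ Lq).
  split; apply: lift_q0 => U Up.
    have [q [qU qp [w qE] qunif]] :=
      left_ideal_nonisolated S_infinite S_vwc Fixk pmin pU Up.
    by exists q; split=> //; exists w.
  exact: (retraction_fiber_nonisolated S_infinite S_vwc pmin pU _ ee Up).
Qed.
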